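(* There is an absolute constant $C>0$ such that for every positive integer $n$ and every real $P\ge 2$, the SoS rank of the Min Knapsack instance $$\min \sum_{i\in[n]} x_i\quad\text{s.t.}\quad \sum_{i\in[n]}x_i\ge \frac1P,\quad \mathbf{x}\in\{0,1\}^n$$ is at most $C\sqrt{n}\log(P)$, i.e. it is $O(\sqrt{n}\log P)$.
   Context: For $n\in\mathbb{N}$, $\Sigma_{n,d}$ is the set of finite sums $\sum_i s_i^2$ of squares of real polynomials in $x_1,\dots,x_n$ of degree at most $d$. Let $\mathcal{H}=\{\pm(x_i^2-x_i): i\in[n]\}$. For a finite set $\mathcal{G}\supseteq\mathcal{H}$ of polynomials, $\Sigma^{\mathcal{G}}_{n,d}$ is the set of polynomials $s_0+\sum_i s_i g_i$ (finite sum) with $g_i\in\mathcal{G}$, $s_i\in\Sigma_{n,d}$, $s_0\in\Sigma_{n,2\lceil(2d+\deg(\mathcal{G}))/2\rceil}$, where $\deg(\mathcal{G})$ is the maximum degree of an element of $\mathcal{G}$. For an objective $f$ and constraint set $\mathcal{G}$, let $\mathcal{G}_+=\{\mathbf{x}\in\mathbb{R}^n: g(\mathbf{x})\ge0\ \forall g\in\mathcal{G}\}$, $f^*=\min\{f(\mathbf{x}):\mathbf{x}\in\mathcal{G}_+\}$, and $f^d_\Sigma=\max\{\lambda\in\mathbb{R}: f-\lambda\in\Sigma^{\mathcal{G}}_{n,d}\}$. The SoS rank is the smallest $d$ with $f^d_\Sigma=f^*$. For the Min Knapsack instance, $f=\sum_i x_i$ and $\mathcal{G}=\mathcal{H}\cup\{\sum_{i\in[n]}x_i-\frac1P\}$.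 *)

(* Defs.v *)
From HB Require Import structures.
From mathcomp Require Import all_boot all_order all_algebra.
From mathcomp Require Import reals.
From mathcomp Require exp.
From mathcomp Require Import mpoly.

Set Implicit Arguments.
Unset Strict Implicit.
Unset Printing Implicit Defensive.

Import Order.TTheory GRing.Theory Num.Theory.

Local Open Scope ring_scope.

Section SumsOfSquares.
Variables (R : realType) (n : nat).
Implicit Types (f p g : {mpoly R[n]}) (G : seq {mpoly R[n]}) (d r : nat).

(* [msize p] is one more than the total degree of [p], and is 0 for [p = 0]. *)
Definition mdegree p : nat := (msize p).-1.

(* The degree bound applies to the polynomials being squared, so that the
   elements of [sos d] have degree up to [2 * d]. *)
Definition sos d p : Prop :=
  exists2 q : seq {mpoly R[n]},
    (forall s, s \in q -> (mdegree s <= d)%N) & p = \sum_(s <- q) s ^+ 2.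

(* Finite sets of polynomials are given by lists of their elements. *)
Definition degset G : nat := (\max_(g <- G) mdegree g)%N.

(* The entries of [t] are the pairs (s_i, g_i); [uphalf m] is the ceiling of
   m / 2. *)
Definition sos_cone G d p : Prop :=
  exists (s0 : {mpoly R[n]}) (t : seq ({mpoly R[n]} * {mpoly R[n]})),
    [/\ sos (2 * uphalf (2 * d + degset G)) s0,
        forall sg, sg \in t -> sos d sg.1 /\ sg.2 \in G
      & p = s0 + \sum_(sg <- t) sg.1 * sg.2].

Definition feasible G (x : 'I_n -> R) : Prop :=
  forall g, g \in G -> 0 <= g.@[x].

Definition is_min (A : R -> Prop) (m : R) : Prop :=
  A m /\ forall y, A y -> m <= y.

Definition is_max (A : R -> Prop) (m : R) : Prop :=
  A m /\ forall y, A y -> y <= m.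

Definition is_opt f G : R -> Prop :=
  is_min (fun y => exists2 x : 'I_n -> R, feasible G x & y = f.@[x]).

Definition is_sos_bound f G d : R -> Prop :=
  is_max (fun l => sos_cone G d (f - l%:MP)).

Definition is_sos_rank f G r : Prop :=
  exists fopt : R,
    [/\ is_opt f G fopt,
        is_sos_bound f G r fopt
      & forall d, is_sos_bound f G d fopt -> (r <= d)%N].

Definition hypercube : seq {mpoly R[n]} :=
  [seq 'X_i ^+ 2 - 'X_i | i <- enum 'I_n]
  ++ [seq - ('X_i ^+ 2 - 'X_i) | i <- enum 'I_n].

Definition knapsack_obj : {mpoly R[n]} := \sum_(i < n) 'X_i.

Definition knapsack_constr (P : R) : seq {mpoly R[n]} :=
  rcons hypercube (\sum_(i < n) 'X_i - (1 / P)%:MP).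

End SumsOfSquares.

(* Main.v *)
Require Import Defs.
From mathcomp Require Import all_boot all_order all_algebra.
From mathcomp Require Import reals.
From mathcomp Require boolp exp.
From mathcomp Require Import mpoly ring lra zify.

(** Write [z] for the sum of the variables.  On the points of the hypercube
    one has [z = 0] or [1 <= z <= n], and [z], [n - z], [z * (z - 1)] are sums
    of squares modulo the ideal of the hypercube.

    The bound [z >= 2 a] is derived from [z >= a], for [a <= 1/2], with a
    multiplier [2 q^2] of degree O(sqrt n); doubling O(log P) times gives the
    theorem.  Here [q = (1 - T(y)) / (T(y0) - 1)], where [T] is the Chebyshev
    polynomial of degree [2^k], the affine change of variable [y] sends
    [z = 1, n + 1] to [1, -1], and [y0 = 1 + 2/n] is the image of [z = 0].
    Since [T] is an iterate of [w |-> 2 w^2 - 1], both [T(y0) - T(y)] and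
    [1 - T(y)] factor as products of Chebyshev polynomials of lower degree,
    hence [1 + q = z A] and [q = (z - 1) B], where [A], [B] and [A - B] are
    visibly nonnegative for [z <= n + 1].  Nonnegativity of
    [z - 2 a - 2 q^2 (z - a)] is then read off the identity
      [z (z - 1) (A - B) (1 - q) + z (z - 1) B (1 - 2 q)
         + (1 - 2 a) z A (1 - q) = z - 2 a - 2 q^2 (z - a)]. *)

Set Implicit Arguments.
Unset Strict Implicit.
Unset Printing Implicit Defensive.

Import Order.TTheory GRing.Theory Num.Theory.

Local Open Scope ring_scope.

(** * Sums of squares modulo the ideal of the hypercube, with degrees *)

Section DegreeBounds.
Variables (R : realType) (n : nat).
Implicit Types p q s h : {mpoly R[n]}.

Lemma mdegreeC (c : R) : mdegree (c%:MP : {mpoly R[n]}) = 0.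
Proof. by rewrite /mdegree mmeasureC; case: (c != 0). Qed.

Lemma mdegreeX i : mdegree ('X_i : {mpoly R[n]}) = 1%N.
Proof. by rewrite /mdegree msizeX mdeg1. Qed.

Lemma mdegreeN p : mdegree (- p) = mdegree p.
Proof. by rewrite /mdegree mmeasureN. Qed.

Lemma mdegreeD_le p q d :
  (mdegree p <= d)%N -> (mdegree q <= d)%N -> (mdegree (p + q) <= d)%N.
Proof. by rewrite /mdegree; have := mmeasureD_le mdeg p q; lia. Qed.

Lemma mdegreeM_le p q d e :
  (mdegree p <= d)%N -> (mdegree q <= e)%N -> (mdegree (p * q) <= d + e)%N.
Proof.
rewrite /mdegree; have [->|p0] := eqVneq p 0; first by rewrite mul0r msize0.
have [->|q0] := eqVneq q 0; first by rewrite mulr0 msize0.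
by rewrite msizeM //; move: (msize p) (msize q); lia.
Qed.

Lemma mdegree_sum_le (I : Type) (r : seq I) (F : I -> {mpoly R[n]}) d :
  (forall i, (mdegree (F i) <= d)%N) -> (mdegree (\sum_(i <- r) F i)%R <= d)%N.
Proof.
move=> hF; elim/big_ind: _ => [|p q|i _] //; last exact: mdegreeD_le.
by rewrite /mdegree msize0.
Qed.

Lemma sos0 d : sos d (0 : {mpoly R[n]}).
Proof. by exists [::] => //; rewrite big_nil. Qed.

Lemma sos_sqr d s : (mdegree s <= d)%N -> sos d (s ^+ 2).
Proof.
by move=> hs; exists [:: s] => [t|]; rewrite ?big_seq1 // inE => /eqP->.
Qed.

Lemma sosD d p q : sos d p -> sos d q -> sos d (p + q).
Proof.
move=> [u hu ->] [v hv ->]; exists (u ++ v); last by rewrite big_cat.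
by move=> s; rewrite mem_cat => /orP[/hu|/hv].
Qed.

Lemma sosW d e p : (d <= e)%N -> sos d p -> sos e p.
Proof. by move=> de [u hu ->]; exists u => // s /hu /leq_trans; apply. Qed.

Lemma sos_ind_sqr d (Q : {mpoly R[n]} -> Prop) :
    Q 0 -> (forall s p, (mdegree s <= d)%N -> Q p -> Q (s ^+ 2 + p)) ->
  forall p, sos d p -> Q p.
Proof.
move=> Q0 QD _ [u hu ->]; elim: u hu => [|s u IHu] hu; first by rewrite big_nil.
rewrite big_cons; apply: QD; first by apply: hu; rewrite inE eqxx.
by apply: IHu => t tu; apply: hu; rewrite inE tu orbT.
Qed.

Lemma sosM d e p q : sos d p -> sos e q -> sos (d + e) (p * q).
Proof.
move=> hp hq; move: p hp; apply: sos_ind_sqr => [|s p hs IHp].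
  by rewrite mul0r; exact: sos0.
rewrite mulrDl; apply: sosD => //.
move: q {IHp} hq; apply: sos_ind_sqr => [|t q ht IHq].
  by rewrite mulr0; exact: sos0.
by rewrite mulrDr -exprMn; apply: sosD => //; apply/sos_sqr/mdegreeM_le.
Qed.

Lemma sosC d (c : R) : 0 <= c -> sos d (c%:MP : {mpoly R[n]}).
Proof.
move=> c0; rewrite -(sqr_sqrtr c0) expr2 mpolyCM -expr2.
by apply: sos_sqr; rewrite mdegreeC.
Qed.

Lemma sos_eval_ge0 d p (x : 'I_n -> R) : sos d p -> 0 <= p.@[x].
Proof.
move: p; apply: sos_ind_sqr => [|s p _ hp]; first by rewrite meval0.
by rewrite mevalD expr2 mevalM addr_ge0 // -expr2 sqr_ge0.
Qed.

(** These are the admissible multipliers of [bool_eq i]: the constraints contain both signs of it,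
    so [u] goes with one sign and [v] with the other. *)
Definition sos_diff d h : Prop :=
  exists u v, [/\ sos d u, sos d v & h = u - v].

Lemma sos_diff_sos d h : sos d h -> sos_diff d h.
Proof. by move=> hh; exists h, 0; split; rewrite ?subr0 //; exact: sos0. Qed.

Lemma sos_diffN d h : sos_diff d h -> sos_diff d (- h).
Proof. by move=> [u [v [hu hv ->]]]; exists v, u; split=> //; rewrite opprB. Qed.

Lemma sos_diffD d h h' : sos_diff d h -> sos_diff d h' -> sos_diff d (h + h').
Proof.
move=> [u [v [hu hv ->]]] [u' [v' [hu' hv' ->]]].
by exists (u + u'), (v + v'); split; [exact: sosD | exact: sosD | ring].
Qed.

Lemma sos_diffM d e h h' :
  sos_diff d h -> sos_diff e h' -> sos_diff (d + e) (h * h').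
Proof.
move=> [u [v [hu hv ->]]] [u' [v' [hu' hv' ->]]].
exists (u * u' + v * v'), (u * v' + v * u').
by split; [apply: sosD; exact: sosM | apply: sosD; exact: sosM | ring].
Qed.

Lemma sos_diffW d e h : (d <= e)%N -> sos_diff d h -> sos_diff e h.
Proof.
by move=> de [u [v [hu hv ->]]]; exists u, v; split=> //; exact: (sosW de).
Qed.

Definition bool_eq i : {mpoly R[n]} := 'X_i ^+ 2 - 'X_i.

Lemma sos_diff_bool_eq i : sos_diff 1 (bool_eq i).
Proof.
pose c : {mpoly R[n]} := (2^-1)%:MP.
(* Completing the square, with [c = 1/2]. *)
exists (('X_i - c) ^+ 2), (c ^+ 2); split.
- apply/sos_sqr/mdegreeD_le; rewrite ?mdegreeX //.
  by rewrite mdegreeN mdegreeC.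
- by apply: sos_sqr; rewrite mdegreeC.
have h2 : c * 2 = 1.
  by rewrite /c -(mpolyC_nat n R 2) -mpolyCM mulVf ?pnatr_eq0 // mpolyC1.
rewrite /bool_eq -{2}['X_i]mulr1 -h2; ring.
Qed.

(* Congruence to an element of [sos d] modulo the ideal of the hypercube, the
   multipliers of the generators having degree at most [2 * d - 2]. *)
Inductive hsos d : {mpoly R[n]} -> Prop :=
| hsos_sos p : sos d p -> hsos d p
| hsos_ideal p h i e :
    hsos d p -> (e < d)%N -> sos_diff e h -> hsos d (p + h * bool_eq i).

Lemma hsosD d p q : hsos d p -> hsos d q -> hsos d (p + q).
Proof.
move=> hp; elim=> [{}q hq|{}q h i e _ IHq ed hh]; last first.
  by rewrite addrA; apply: hsos_ideal IHq ed hh.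
elim: hp => [{}p hp|{}p h i e _ IHp ed hh]; first exact/hsos_sos/sosD.
by rewrite addrAC; apply: hsos_ideal IHp ed hh.
Qed.

Lemma hsos_sum d (I : Type) (r : seq I) (A : pred I) (F : I -> {mpoly R[n]}) :
  (forall i, A i -> hsos d (F i)) -> hsos d (\sum_(i <- r | A i) F i).
Proof.
move=> hF; elim/big_ind: _ => // [|p q]; last exact: hsosD.
exact/hsos_sos/sos0.
Qed.

Lemma hsosW d e p : (d <= e)%N -> hsos d p -> hsos e p.
Proof.
move=> de; elim=> [{}p hp|{}p h i e' _ IHp ed hh].
  exact/hsos_sos/(sosW de).
by apply: hsos_ideal IHp (leq_trans ed de) hh.
Qed.

(** Each [bool_eq i] is itself a difference of squares, so the ideal terms are absorbed. This lets
    [p] serve as a multiplier of a generator. *)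
Lemma hsos_diff d p : hsos d p -> sos_diff d p.
Proof.
elim=> [{}p hp|{}p h i e _ IHp ed hh]; first exact: sos_diff_sos.
apply: sos_diffD => //; apply: (@sos_diffW (e + 1)); first by rewrite addn1.
by apply: sos_diffM => //; exact: sos_diff_bool_eq.
Qed.

Lemma hsos_mul_bool_eq d p i : hsos d p -> hsos d.+1 (p * bool_eq i).
Proof.
move=> /hsos_diff hp; rewrite -[_ * _]add0r.
by apply: (@hsos_ideal _ _ _ _ d) => //; apply/hsos_sos/sos0.
Qed.

(** Viewing a nonnegative polynomial as an operator on certificates makes closure under products
    mere composition, with degrees adding up; applying it to 1 gives back a certificate. *)
Definition hmult e p : Prop :=
  forall d q, hsos d q -> hsos (d + e) (p * q).

Lemma hmult_sos e s : sos e s -> hmult e s.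
Proof.
move=> hs d q; elim=> [{}q hq|{}q h i e' _ IHq ed hh].
  by rewrite mulrC; apply/hsos_sos/sosM.
rewrite mulrDr mulrA; apply: (@hsos_ideal _ _ _ _ (e' + e)) => //.
  by rewrite ltn_add2r.
by rewrite mulrC; apply: sos_diffM => //; exact: sos_diff_sos.
Qed.

Lemma hmult_hsos e p : hmult e p -> hsos e p.
Proof.
move=> /(_ 0 1); rewrite mulr1; apply; apply/hsos_sos.
by rewrite -mpolyC1; exact: sosC.
Qed.

Lemma hmultW d e p : (d <= e)%N -> hmult d p -> hmult e p.
Proof. by move=> de hp k q /hp; apply: hsosW; rewrite leq_add2l. Qed.

Lemma hmultD e p q : hmult e p -> hmult e q -> hmult e (p + q).
Proof.
by move=> hp hq d r hr; rewrite mulrDl; apply: hsosD; [exact: hp | exact: hq].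
Qed.

Lemma hmultM d e p q : hmult d p -> hmult e q -> hmult (d + e) (p * q).
Proof.
by move=> hp hq k r hr; rewrite -mulrA [(d + e)%N]addnC addnA; apply/hp/hq.
Qed.

Lemma hmultC e (c : R) : 0 <= c -> hmult e c%:MP.
Proof. by move=> c0; apply/hmult_sos/sosC. Qed.

Lemma hmultCM e (c : R) p : 0 <= c -> hmult e p -> hmult e (c%:MP * p).
Proof.
by move=> c0 hp; rewrite -[e]add0n; apply: hmultM => //; exact: hmultC.
Qed.

Lemma hmult_sum e (I : Type) (r : seq I) (A : pred I) (F : I -> {mpoly R[n]}) :
  (forall i, A i -> hmult e (F i)) -> hmult e (\sum_(i <- r | A i) F i).
Proof.
by move=> hF d q hq; rewrite mulr_suml; apply: hsos_sum => i /hF; apply.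
Qed.

(** Modulo the ideal ['X_i] equals its own square; the correction has multiplier [- q], admissible
    by [hsos_diff]. *)
Lemma hmultX i : hmult 1 'X_i.
Proof.
move=> d q hq.
have -> : 'X_i * q = 'X_i ^+ 2 * q + (- q) * bool_eq i by rewrite /bool_eq; ring.
apply: (@hsos_ideal _ _ _ _ d); rewrite ?addn1 //; last exact/sos_diffN/hsos_diff.
by rewrite -addn1; apply: hmult_sos hq; apply: sos_sqr; rewrite mdegreeX.
Qed.

Lemma hmult1BX i : hmult 1 (1 - 'X_i).
Proof.
move=> d q hq.
have -> : (1 - 'X_i) * q = (1 - 'X_i) ^+ 2 * q + (- q) * bool_eq i.
  by rewrite /bool_eq; ring.
apply: (@hsos_ideal _ _ _ _ d); rewrite ?addn1 //; last exact/sos_diffN/hsos_diff.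
rewrite -addn1; apply: hmult_sos hq; apply/sos_sqr/mdegreeD_le.
  by rewrite -mpolyC1 mdegreeC.
by rewrite mdegreeN mdegreeX.
Qed.

Local Notation z := (knapsack_obj R n).

Lemma hmult_obj : hmult 1 z.
Proof. by apply: hmult_sum => i _; exact: hmultX. Qed.

Lemma hmult_nBobj : hmult 1 (n%:R - z).
Proof.
have -> : n%:R - z = \sum_(i < n) (1 - 'X_i).
  by rewrite sumrB sumr_const card_ord.
by apply: hmult_sum => i _; exact: hmult1BX.
Qed.

Lemma hmult_objM : hmult 2 (z * (z - 1)).
Proof.
(* The off-diagonal products are nonnegative, and the diagonal of [z ^+ 2] minus [z] lies in the
   ideal. *)
have -> : z * (z - 1)
    = \sum_(i < n) (\sum_(j < n | j != i) 'X_i * 'X_j + bool_eq i).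
  rewrite mulr_suml; apply: eq_bigr => i _.
  by rewrite -mulr_sumr /knapsack_obj (bigD1 i) //= /bool_eq; ring.
apply: hmult_sum => i _; apply: hmultD; last first.
  move=> d q hq; rewrite mulrC addn2; apply: hsosW (hsos_mul_bool_eq _ hq).
  exact: leqnSn.
by apply: hmult_sum => j _; apply: (@hmultM 1 1); exact: hmultX.
Qed.

End DegreeBounds.

(** * Chebyshev polynomials of degree a power of two *)

Section Doubling.
Variable A : comNzRingType.

(* Chebyshev polynomial of degree [2 ^ k], as [T_(2m) = 2 T_m^2 - 1]. *)
Definition cheb2 k (x : A) : A := iter k (fun w => 2 * w ^+ 2 - 1) x.

Lemma cheb2_1 k : cheb2 k 1 = 1.
Proof. by elim: k => //= k ->; rewrite expr1n mulr1 addrK. Qed.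

(** Iterates [T_(2m)(x) - T_(2m)(y) = 2 (T_m(x) - T_m(y)) (T_m(x) + T_m(y))]. *)
Lemma cheb2_sub k (x y : A) :
  cheb2 k x - cheb2 k y
  = 2 ^+ k * (x - y) * \prod_(j < k) (cheb2 j x + cheb2 j y).
Proof.
elim: k => [|k IHk]; first by rewrite big_ord0 expr0 mulr1 mul1r.
rewrite big_ord_recr /=.
have -> : 2 * cheb2 k x ^+ 2 - 1 - (2 * cheb2 k y ^+ 2 - 1)
  = 2 * (cheb2 k x - cheb2 k y) * (cheb2 k x + cheb2 k y) by ring.
by rewrite IHk (exprS _ k); ring.
Qed.

End Doubling.

Lemma rmorph_cheb2 (A B : comNzRingType) (f : {rmorphism A -> B}) k x :
  cheb2 k (f x) = f (cheb2 k x).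
Proof.
elim: k => //= k ->.
by rewrite rmorphB rmorph1 rmorphM rmorphXn rmorph_nat.
Qed.

(** From [2 (1 + v)^2 - 1 >= 1 + 4 v]. The quadratic growth in the degree [2 ^ k] is why degree
    O(sqrt n) suffices for [u = 2 / n]. *)
Lemma cheb2_growth (R : realFieldType) k (u : R) :
  0 <= u -> 1 + 4 ^+ k * u <= cheb2 k (1 + u).
Proof.
move=> u0; elim: k => [|k /=]; first by rewrite expr0 mul1r.
have : 0 <= 4 ^+ k * u by rewrite mulr_ge0 // exprn_ge0.
by rewrite (exprS _ k) -mulrA; move: (4 ^+ k * u) (cheb2 k (1 + u)) => v w; nra.
Qed.

(** * The multiplier that doubles the lower bound on [z], and its iteration *)

Section DoublingStep.
Variables (R : realType) (n : nat).
Hypothesis n_gt0 : (0 < n)%N.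

Local Notation z := (knapsack_obj R n).
Local Notation c := ((2 / n%:R)%:MP : {mpoly R[n]}).

Definition cheb_arg : {mpoly R[n]} := 1 + c - c * z.
Local Notation y := cheb_arg.

Lemma mdegree_obj : (mdegree z <= 1)%N.
Proof. by apply: mdegree_sum_le => i; rewrite mdegreeX. Qed.

Lemma mdegree_cheb2 k : (mdegree (cheb2 k y) <= 2 ^ k)%N.
Proof.
elim: k => [|k IHk].
  rewrite /= /cheb_arg -mpolyC1 -mpolyCD; apply: mdegreeD_le.
    by rewrite mdegreeC.
  rewrite mdegreeN; apply: (@mdegreeM_le _ _ _ _ 0 1); first by rewrite mdegreeC.
  exact: mdegree_obj.
rewrite /= -(mpolyC_nat n R 2) -mpolyC1; apply: mdegreeD_le.
  rewrite -[(2 ^ k.+1)%N]add0n; apply: mdegreeM_le; first by rewrite mdegreeC.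
  by rewrite expnS mul2n -addnn expr2; apply: mdegreeM_le.
by rewrite mdegreeN mdegreeC.
Qed.

(** For [k = 0] this is [(2 / n) (n - z + 1)]; for larger [k] it is twice a square. *)
Lemma hmult_1Dcheb2 k : hmult (2 ^ k) (1 + cheb2 k y).
Proof.
case: k => [|k] /=.
  have hc : c * n%:R = 2.
    by rewrite -!mpolyC_nat -mpolyCM divfK // pnatr_eq0 -lt0n.
  have -> : 1 + y = c * ((n%:R - z) + 1).
    by rewrite /cheb_arg mulrDr mulrBr hc; ring.
  apply: hmultCM; first by rewrite divr_ge0.
  by apply: hmultD; [exact: hmult_nBobj | rewrite -mpolyC1; exact: hmultC].
have -> : 1 + (2 * cheb2 k y ^+ 2 - 1) = 2 * cheb2 k y ^+ 2 by ring.
rewrite -(mpolyC_nat n R 2); apply: hmultCM => //; apply/hmult_sos/sos_sqr.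
by apply: leq_trans (mdegree_cheb2 k) _; rewrite leq_exp2l.
Qed.

Section Products.
Variable t : R.
Hypothesis t_ge1 : forall k, 1 <= cheb2 k t.

Lemma hmult_tDcheb2 k : hmult (2 ^ k) ((cheb2 k t)%:MP + cheb2 k y).
Proof.
have -> : (cheb2 k t)%:MP + cheb2 k y = (cheb2 k t - 1)%:MP + (1 + cheb2 k y).
  by rewrite mpolyCB mpolyC1; ring.
by apply: hmultD (hmult_1Dcheb2 k); apply: hmultC; rewrite subr_ge0.
Qed.

(** The degrees [1, 2, 4, ...] of the factors add up to less than [2 ^ k]. *)
Lemma hmult_prod_tDcheb2 k :
  hmult (2 ^ k) (\prod_(j < k) ((cheb2 j t)%:MP + cheb2 j y)).
Proof.
elim: k => [|k IHk]; first by rewrite big_ord0 -mpolyC1; exact: hmultC.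
rewrite big_ord_recr expnS mul2n -addnn.
by apply: hmultM => //; exact: hmult_tDcheb2.
Qed.

Lemma hmult_prod_1Dcheb2 k : hmult (2 ^ k) (\prod_(j < k) (1 + cheb2 j y)).
Proof.
elim: k => [|k IHk]; first by rewrite big_ord0 -mpolyC1; exact: hmultC.
rewrite big_ord_recr expnS mul2n -addnn.
by apply: hmultM => //; exact: hmult_1Dcheb2.
Qed.

(** Up to a positive constant this is [A - B]. The factors of the two products differ by the
    constants [cheb2 j t - 1 >= 0], so the difference telescopes into nonnegative terms. *)
Lemma hmult_prodB k :
  hmult (2 ^ k) (\prod_(j < k) ((cheb2 j t)%:MP + cheb2 j y)
                 - \prod_(j < k) (1 + cheb2 j y)).
Proof.
elim: k => [|k IHk]; first by rewrite !big_ord0 subrr -mpolyC0; exact: hmultC.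
rewrite !big_ord_recr /=; set X := \prod_(j < k) _ in IHk *.
set Y := \prod_(j < k) _ in IHk *.
have -> : X * ((cheb2 k t)%:MP + cheb2 k y) - Y * (1 + cheb2 k y)
  = (X - Y) * ((cheb2 k t)%:MP + cheb2 k y) + (cheb2 k t - 1)%:MP * Y.
  by rewrite mpolyCB mpolyC1; ring.
rewrite expnS mul2n -addnn; apply: hmultD.
  by apply: hmultM => //; exact: hmult_tDcheb2.
apply: hmultCM; first by rewrite subr_ge0.
by apply: hmultW (hmult_prod_1Dcheb2 k); rewrite leq_addr.
Qed.

End Products.

Lemma bound_doubling k : (2 * n <= 4 ^ k)%N ->
  exists2 q : {mpoly R[n]}, (mdegree q <= 2 ^ k)%N &
    forall a : R, a <= 2^-1 ->
      hsos (2 ^ k.+1 + 2)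
        ((z - (2 * a)%:MP) - (2%:MP * q ^+ 2) * (z - a%:MP)).
Proof.
move=> nk; pose t : R := 1 + 2 / n%:R.
have n0 : 0 < n%:R :> R by rewrite ltr0n.
have u0 : 0 <= 2 / n%:R :> R by rewrite divr_ge0.
have t_ge1 j : 1 <= cheb2 j t.
  by apply: le_trans (cheb2_growth j u0); rewrite lerDl mulr_ge0 // exprn_ge0.
pose D := cheb2 k t - 1.
(* The value 4 is what [1 - 2 q] needs to be nonnegative, and it is what [2 * n <= 4 ^ k]
   provides. *)
have D4 : 4 <= D.
  rewrite /D lerBrDr addrC; apply: le_trans (cheb2_growth k u0).
  rewrite lerD2l mulrA ler_pdivlMr //.
  have : (2 * n)%:R <= (4 ^ k)%:R :> R by rewrite ler_nat.
  by rewrite natrX natrM; lra.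
have D0 : 0 < D by lra.
pose g : {mpoly R[n]} := D^-1%:MP.
have gD : g * ((cheb2 k t)%:MP - 1) = 1.
  by rewrite -mpolyC1 -mpolyCB -mpolyCM mulVf ?gt_eqF // mpolyC1.
pose T := cheb2 k y; pose q := g * (1 - T).
pose X := \prod_(j < k) ((cheb2 j t)%:MP + cheb2 j y).
pose Y := \prod_(j < k) (1 + cheb2 j y).
(* With this constant, [A = w * X] and [B = w * Y]. *)
pose w : {mpoly R[n]} := (D^-1 * (2 ^+ k * (2 / n%:R)))%:MP.
have wE : w = g * (2 ^+ k * c).
  by rewrite /w 2!mpolyCM -!natrX mpolyC_nat.
have qz : 1 + q = z * (w * X).
  have -> : 1 + q = g * ((cheb2 k t)%:MP - T) by rewrite -gD /q; ring.
  rewrite -(rmorph_cheb2 (@mpolyC n R)) cheb2_sub wE.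
  under eq_bigr do rewrite (rmorph_cheb2 (@mpolyC n R)).
  by rewrite /= -/X /y /t mpolyCD mpolyC1; ring.
have qz1 : q = (z - 1) * (w * Y).
  rewrite /q -{1}(cheb2_1 _ k) cheb2_sub wE.
  under eq_bigr do rewrite cheb2_1.
  by rewrite -/Y /y; ring.
exists q.
  rewrite -[(2 ^ k)%N]add0n; apply: mdegreeM_le; first by rewrite mdegreeC.
  apply: mdegreeD_le; first by rewrite -mpolyC1 mdegreeC.
  by rewrite mdegreeN mdegree_cheb2.
have h1Bq (b : R) : 0 <= b <= 2 -> hmult (2 ^ k) (1 - b%:MP * q).
  (* The constant [D - 2 * b] is nonnegative because [b <= 2] and [D >= 4]. *)
  move=> hb; have -> : 1 - b%:MP * q = g * ((D - 2 * b)%:MP + b%:MP * (1 + T)).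
    rewrite mpolyCB mpolyCM mpolyCB mpolyC1 (mpolyC_nat n R 2) /q.
    by rewrite -{1}gD; ring.
  apply: hmultCM; first by rewrite invr_ge0 ltW.
  apply: hmultD; first by apply: hmultC; lra.
  by apply: hmultCM; [lra | exact: hmult_1Dcheb2].
have w0 : 0 <= D^-1 * (2 ^+ k * (2 / n%:R)).
  by rewrite !mulr_ge0 ?invr_ge0 ?exprn_ge0 // ltW.
move=> a ha.
have -> : z - (2 * a)%:MP - 2%:MP * q ^+ 2 * (z - a%:MP)
  = (z * (z - 1)) * (w * (X - Y) * (1 - 1%:MP * q))
    + (z * (z - 1)) * (w * Y * (1 - 2%:MP * q))
    + (1 - 2 * a)%:MP * (z * (w * X * (1 - 1%:MP * q))).
  rewrite mpolyCB !mpolyCM !mpolyC1 (mpolyC_nat n R 2).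
  (* Regroup so that [z * (w * X)] and [(z - 1) * (w * Y)] fold into [1 + q] and [q]; the rest is an
     identity in [z], [q] and [a]. *)
  have -> : z * (z - 1) * (w * (X - Y) * (1 - 1 * q))
    = (z * (w * X)) * (z - 1) * (1 - q) - z * ((z - 1) * (w * Y)) * (1 - q).
    by ring.
  have -> : z * (z - 1) * (w * Y * (1 - 2 * q))
    = z * ((z - 1) * (w * Y)) * (1 - 2 * q) by ring.
  have -> : z * (w * X * (1 - 1 * q)) = (z * (w * X)) * (1 - q) by ring.
  by rewrite -qz -qz1; ring.
have h11 : (2 ^ k.+1 = 2 ^ k + 2 ^ k)%N by rewrite expnS mul2n addnn.
have hb1 : 0 <= (1 : R) <= 2 by lra.
have hb2 : 0 <= (2 : R) <= 2 by lra.
apply: hmult_hsos; apply: hmultD; last first.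
  apply: hmultCM; first lra.
  apply: (@hmultW _ _ (1 + 2 ^ k.+1)); first by rewrite addnC leq_add2l.
  apply: hmultM (@hmult_obj _ _) _; rewrite h11; apply: hmultM (h1Bq _ hb1).
  by apply: hmultCM => //; exact: hmult_prod_tDcheb2.
rewrite addnC h11; apply: hmultD; apply: hmultM (@hmult_objM _ _) _;
  apply: hmultM (h1Bq _ _) => //; apply: hmultCM => //.
  exact: hmult_prodB.
exact: hmult_prod_1Dcheb2.
Qed.

(** The same [q] works for every [a], so [s] is the [L]-th power of [2 q^2]. Only the degree of [s]
    grows with [L]: each step adds its remainder, of fixed degree, multiplied by the current [s]. *)
Lemma bound_halvings k L : (2 * n <= 4 ^ k)%N ->
  exists2 s : {mpoly R[n]}, sos (L * 2 ^ k) s &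
    hsos (L * 2 ^ k + 2 ^ k.+1 + 2) (z - 1 - s * (z - ((2^-1) ^+ L)%:MP)).
Proof.
move=> nk; elim: L => [|L [s hs hK]].
  exists 1; first by rewrite -mpolyC1; exact: sosC.
  by rewrite expr0 mpolyC1 mul1r subrr; apply/hsos_sos/sos0.
have [q hq hstep] := bound_doubling nk.
have aL : 2^-1 ^+ L.+1 <= 2^-1 :> R.
  rewrite exprS ler_piMr ?invr_ge0 // exprn_ile1 ?invr_ge0 //; lra.
have hq2 : sos (2 ^ k) (2%:MP * q ^+ 2 : {mpoly R[n]}).
  by rewrite -[(2 ^ k)%N]add0n; apply: sosM; [exact: sosC | exact: sos_sqr].
exists (s * (2%:MP * q ^+ 2)); first by rewrite mulSn addnC; exact: sosM.
have {hstep} := hstep _ aL.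
have -> : 2 * 2^-1 ^+ L.+1 = 2^-1 ^+ L :> R.
  by rewrite exprS mulrA divff ?mul1r ?pnatr_eq0.
move: (2^-1 ^+ L.+1) (2^-1 ^+ L) hK => a b hK hstep.
have -> : z - 1 - s * (2%:MP * q ^+ 2) * (z - a%:MP)
  = (z - 1 - s * (z - b%:MP))
    + s * (z - b%:MP - 2%:MP * q ^+ 2 * (z - a%:MP)) by ring.
apply: hsosD; first by apply: hsosW hK; rewrite mulSn; lia.
by apply: hsosW (hmult_sos hs hstep); rewrite mulSn; lia.
Qed.

End DoublingStep.

(** * Certificates, optimum and rank of the knapsack instance *)

Section Knapsack.
Variables (R : realType) (n : nat).
Implicit Types (p s g : {mpoly R[n]}) (G : seq {mpoly R[n]}).

Lemma sos_cone_addM G d p s g :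
  sos_cone G d p -> sos d s -> g \in G -> sos_cone G d (p + s * g).
Proof.
move=> [s0 [r [hs0 hr ->]]] hs gG; exists s0, ((s, g) :: r); split=> //.
  by move=> sg; rewrite inE => /orP[/eqP->|/hr].
by rewrite big_cons /=; ring.
Qed.

Lemma sos_cone_hsos G d p :
  {subset hypercube R n <= G} -> hsos d p -> sos_cone G d p.
Proof.
move=> HG; elim=> [{}p hp|{}p h i e _ IHp ed [u [v [hu hv ->]]]].
  exists p, [::]; split; rewrite ?big_nil ?addr0 //.
  by apply: sosW hp; rewrite uphalf_half; lia.
have -> : p + (u - v) * bool_eq R i
  = p + u * bool_eq R i + v * (- bool_eq R i) by ring.
apply: sos_cone_addM; first apply: sos_cone_addM => //.
- exact: sosW (ltnW ed) hu.
- by apply: HG; rewrite mem_cat map_f // mem_enum.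
- exact: sosW (ltnW ed) hv.
by apply: HG; rewrite mem_cat orbC (map_f (fun i => - bool_eq R i)) // mem_enum.
Qed.

(** Soundness: no certified bound exceeds the optimum, so a certificate for the optimum is
    automatically the best one. *)
Lemma sos_cone_eval_ge0 G d p (x : 'I_n -> R) :
  feasible G x -> sos_cone G d p -> 0 <= p.@[x].
Proof.
move=> hx [s0 [r [hs0 hr ->]]]; rewrite mevalD addr_ge0 ?(sos_eval_ge0 x hs0) //.
rewrite raddf_sum big_seq sumr_ge0 // => sg /hr[hs hg].
by rewrite /= mevalM; apply: mulr_ge0; [exact: sos_eval_ge0 hs | exact: hx].
Qed.

Lemma eval_obj (x : 'I_n -> R) : (knapsack_obj R n).@[x] = \sum_i x i.
Proof. by rewrite raddf_sum /=; apply: eq_bigr => i _; rewrite mevalXU. Qed.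

Lemma eval_bool_eq (x : 'I_n -> R) i : (bool_eq R i).@[x] = x i * (x i - 1).
Proof. by rewrite /bool_eq mevalB expr2 mevalM mevalXU; ring. Qed.

Lemma feasible_knapsackP (P : R) (x : 'I_n -> R) :
  feasible (knapsack_constr n P) x <->
  (forall i, x i = 0 \/ x i = 1) /\ P^-1 <= \sum_i x i.
Proof.
split=> [hx|[x01 hP] g].
  split=> [i|]; last first.
    rewrite -div1r; have := hx (knapsack_obj R n - (1 / P)%:MP).
    rewrite mevalB mevalC eval_obj subr_ge0; apply.
    by rewrite mem_rcons; exact: mem_head.
  have h1 : 0 <= (bool_eq R i).@[x].
    by apply: hx; rewrite mem_rcons inE mem_cat map_f ?orbT // mem_enum.
  have h2 : 0 <= (- bool_eq R i).@[x].
    apply: hx; rewrite mem_rcons inE mem_cat.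
    by rewrite (map_f (fun i => - bool_eq R i)) ?orbT // mem_enum.
  have : x i * (x i - 1) == 0.
    by rewrite -eval_bool_eq eq_le h1 -oppr_ge0 -mevalN h2.
  by rewrite mulf_eq0 subr_eq0 => /orP[]/eqP->; [left | right].
have e0 i : (bool_eq R i).@[x] = 0.
  by rewrite eval_bool_eq; case: (x01 i) => ->; rewrite ?mul0r // subrr mulr0.
rewrite mem_rcons inE mem_cat => /or3P[/eqP->|/mapP[i _ ->]|/mapP[i _ ->]].
- by rewrite mevalB mevalC -/(knapsack_obj R n) eval_obj subr_ge0 div1r.
- by rewrite -/(bool_eq R i) e0.
- by rewrite -/(bool_eq R i) mevalN e0 oppr0.
Qed.

(** Since [0 < 1 / P <= 1], the origin is cut off while the unit vectors remain feasible. *)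
Lemma knapsack_opt (P : R) :
  (0 < n)%N -> 2 <= P -> is_opt (knapsack_obj R n) (knapsack_constr n P) 1.
Proof.
move=> n0 P2; have P0 : 0 < P by lra.
split=> [|_ [x /feasible_knapsackP[x01 hP] ->]].
  pose i0 := Ordinal n0; pose x (i : 'I_n) : R := (i == i0)%:R.
  have sx : \sum_i x i = 1.
    by rewrite (bigD1 i0) //= big1 ?addr0 /x ?eqxx // => i /negPf ->.
  exists x; last by rewrite eval_obj sx.
  apply/feasible_knapsackP; split=> [i|]; last by rewrite sx invf_le1 //; lra.
  by rewrite /x; case: (i == i0); [right | left].
rewrite eval_obj.
have [i /eqP xi|x0] := pickP (fun i => x i == 1).
  rewrite (bigD1 i) //= xi lerDl sumr_ge0 // => j _.
  by case: (x01 j) => ->.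
move: hP; rewrite big1 => [|i _]; first by rewrite leNgt invr_gt0 P0.
by case: (x01 i) => // xi; move: (x0 i); rewrite xi eqxx.
Qed.

Lemma knapsack_rank_le (P : R) d :
    (0 < n)%N -> 2 <= P ->
    sos_cone (knapsack_constr n P) d (knapsack_obj R n - 1%:MP) ->
  exists2 r,
    is_sos_rank (knapsack_obj R n) (knapsack_constr n P) r & (r <= d)%N.
Proof.
move=> n0 P2 hd; pose f := knapsack_obj R n; pose G := knapsack_constr n P.
have hopt := knapsack_opt n0 P2.
(* [asbool] turns the predicate into a boolean one, as taking the least degree requires. *)
have exd : exists e, boolp.asbool (sos_cone G e (f - 1%:MP)).
  by exists d; apply/boolp.asboolP.
have [r /boolp.asboolP hr rmin] := ex_minnP exd.
exists r; last by apply: rmin; apply/boolp.asboolP.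
exists 1; split=> //; last by move=> e [he _]; apply: rmin; apply/boolp.asboolP.
split=> // l hl; case: hopt => -[x hx ->] _.
by have := sos_cone_eval_ge0 hx hl; rewrite mevalB mevalC subr_ge0.
Qed.

(** As [2^-L <= 1 / P], replacing the bound [2^-L] by [1 / P] costs only a nonnegative multiple of
    [s]. *)
Lemma knapsack_cone (P : R) k L :
    (0 < n)%N -> 0 < P -> (2 * n <= 4 ^ k)%N -> P <= 2 ^+ L ->
  sos_cone (knapsack_constr n P) (L * 2 ^ k + 2 ^ k.+1 + 2)
    (knapsack_obj R n - 1%:MP).
Proof.
move=> n0 P0 nk PL; have [s hs] := bound_halvings R n0 L nk.
rewrite mpolyC1; set z := knapsack_obj R n; set a := 2^-1 ^+ L => hK.
have aP : 0 <= 1 / P - a.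
  by rewrite subr_ge0 div1r /a exprVn lef_pV2 ?posrE // exprn_gt0.
have sW : sos (L * 2 ^ k + 2 ^ k.+1 + 2) s by apply: sosW hs; lia.
have -> : z - 1
  = (z - 1 - s * (z - a%:MP)) + (1 / P - a)%:MP * s + s * (z - (1 / P)%:MP).
  by rewrite mpolyCB; ring.
apply: sos_cone_addM => //; last by rewrite mem_rcons; exact: mem_head.
apply: sos_cone_hsos => [p ph|]; first by rewrite mem_rcons inE ph orbT.
apply: hsosD => //; apply: hsos_sos; rewrite -[X in sos X _]add0n.
by apply: sosM => //; exact: sosC.
Qed.

End Knapsack.

(** * Choice of the parameters and the final estimate *)

Lemma exists_pow4_bounds n : (0 < n)%N ->
  exists2 k, (2 * n <= 4 ^ k)%N & (4 ^ k <= 8 * n)%N.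
Proof.
move=> n0; have n1 : (1 < 2 * n)%N by lia.
have /andP[lo hi] := up_log_bounds (isT : 1 < 4)%N n1.
exists (up_log 4 (2 * n)) => //.
move: lo; have := up_log_gt0 4 (2 * n); rewrite n1 /=.
by case: (up_log 4 (2 * n)) => // m _ /=; rewrite expnS; lia.
Qed.

Lemma exists_pow2_bounds (R : realType) (P : R) : 2 <= P ->
  exists2 L, P <= 2 ^+ L & (0 < L)%N /\ 2 ^+ L.-1 <= P.
Proof.
move=> P2; have exL : exists L, P <= 2 ^+ L.
  exists (Num.bound P).
  have /archi_boundP/ltW/le_trans : 0 <= P by lra.
  by apply; rewrite -natrX ler_nat ltnW // ltn_expl.
case: (ex_minnP exL) => -[|L] hL Lmin; first by move: hL; rewrite expr0; lra.
exists L.+1 => //; split=> //=; apply/ltW; rewrite ltNge.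
by apply/negP => /Lmin; rewrite ltnn.
Qed.

Theorem theorem2 (R : realType) :
  exists2 C : R, 0 < C &
    forall (n : nat) (P : R), (0 < n)%N -> 2 <= P ->
      exists2 r : nat,
        is_sos_rank (knapsack_obj R n) (knapsack_constr n P) r &
        r%:R <= C * Num.sqrt n%:R * exp.ln P.
Proof.
have ln2 : 0 < exp.ln 2 :> R by apply: exp.ln_gt0; lra.
(* Here [30 = 5 * 2 * 3], from [r <= 5 L 2^k], [L <= 2 ln P / ln 2] and [2^k <= 3 sqrt n]. *)
exists (30 / exp.ln 2); first by rewrite divr_gt0.
move=> n P n0 P2; have P0 : 0 < P by lra.
have [k nk kn] := exists_pow4_bounds n0.
have [L PL [L0 LP]] := exists_pow2_bounds P2.
have [r hr rle] := knapsack_rank_le n0 P2 (knapsack_cone n0 P0 nk PL).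
exists r => //.
(* The lower-order terms are absorbed using [L >= 1] and [2 ^ k >= 1]. *)
have rle' : (r <= 5 * (L * 2 ^ k))%N.
  by apply: leq_trans rle _; have := expn_gt0 2 k; rewrite expnS; nia.
have kR : (2 ^ k)%:R <= 3 * Num.sqrt n%:R :> R.
  rewrite -(@ler_pXn2r _ 2) ?nnegrE ?mulr_ge0 ?sqrtr_ge0 //.
  rewrite exprMn sqr_sqrtr ?ler0n // -!natrX -natrM ler_nat.
  by rewrite -expnM [(k * 2)%N]mulnC expnM (leq_trans kn) // leq_mul2r orbT.
(* Minimality of [L] bounds [L - 1] by [ln P / ln 2]; the missing 1 is at most the same quantity
   because [P >= 2]. *)
have LR : L%:R <= 2 * exp.ln P / exp.ln 2.
  rewrite ler_pdivlMr //.
  have : exp.ln (2 ^+ L.-1) <= exp.ln P.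
    by rewrite exp.ler_ln ?posrE // exprn_gt0.
  rewrite exp.lnXn // -mulr_natl.
  have : exp.ln 2 <= exp.ln P by rewrite exp.ler_ln ?posrE.
  have -> : L%:R = L.-1%:R + 1 :> R by rewrite natr1 prednK.
  by rewrite mulrDl mul1r; lra.
apply: (@le_trans _ _ (5 * ((2 * exp.ln P / exp.ln 2) * (3 * Num.sqrt n%:R)))).
  apply: le_trans (_ : (5 * (L * 2 ^ k))%:R <= _); first by rewrite ler_nat.
  by rewrite 2!natrM ler_pM2l // ler_pM.
by rewrite le_eqVlt; apply/orP; left; apply/eqP; field; rewrite gt_eqF.
Qed.
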